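(* For every $m\geq 4$, the helm graph $H_m$ satisfies $F_d(H_m)=m=\gamma(H_m)$.
   Context: The helm graph $H_m$ ($m\geq 4$) is obtained from a wheel by attaching a pendant edge to each vertex of the wheel's cycle, where the cycle has $m$ vertices. Explicitly, it has a center $v_0$, cycle vertices $v_1,\dots,v_m$ and pendant vertices $u_1,\dots,u_m$ (so $2m+1$ vertices); $v_1,\dots,v_m$ form a cycle in this order, $v_0$ is adjacent to every $v_i$ ($1\le i\le m$), each $u_i$ is adjacent only to $v_i$, and there are no other edges. Zero forcing: given a set $B\subseteq V(G)$ of initially black vertices (all others white) of a finite simple graph $G$, at each step a black vertex having exactly one white neighbor forces that neighbor to become black; $B$ is a zero forcing set of $G$ if repeated application of this rule turns all vertices black. A set $D\subseteq V(G)$ is dominating if every vertex of $G$ is in $D$ or adjacent to a vertex of $D$; $\gamma(G)$ is the minimum cardinality of a dominating set. A dom-forcing set of $G$ is a set $D_f\subseteq V(G)$ that is both a dominating set of $G$ and a zero forcing set of $G$; the dom-forcing number $F_d(G)$ is the minimum cardinality of a dom-forcing set. *)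

(* Defs.v *)
From mathcomp Require Import all_boot.

Set Implicit Arguments.
Unset Strict Implicit.
Unset Printing Implicit Defensive.

Record sgraph := SGraph {
  svertex :> finType;
  adj : rel svertex;
  adj_sym : symmetric adj;
  adj_irrefl : irreflexive adj }.

Section GraphParameters.
Variable G : sgraph.
Implicit Types B D : {set G}.

Definition dominating D : bool :=
  [forall x : G, (x \in D) || [exists y in D, adj x y]].

Definition white_neighbors B (x : G) : {set G} :=
  [set y | adj x y & y \notin B].

Definition forces B (x y : G) : bool :=
  (x \in B) && (white_neighbors B x == [set y]).

Definition force_step : rel {set G} :=
  fun B B' => [exists x : G, exists y : G, forces B x y && (B' == y |: B)].

(* [connect] is the reflexive-transitive closure. Performing the forces one at
   a time loses nothing: the forcing rule is confluent. *)
Definition zero_forcing B : bool := connect force_step B [set: G].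

Definition dom_forcing D : bool := dominating D && zero_forcing D.

Lemma dominatingT : dominating [set: G].
Proof. by apply/forallP => x; rewrite inE. Qed.

Lemma dom_forcingT : dom_forcing [set: G].
Proof. by rewrite /dom_forcing dominatingT /zero_forcing connect0. Qed.

(* Both minima are over nonempty families, by the two lemmas above, so the
   starting point [set: G] of the searches does not affect their values. *)
Definition domination_number : nat :=
  #|[arg min_(D < [set: G] | dominating D) #|D| ]|.

Definition dom_forcing_number : nat :=
  #|[arg min_(D < [set: G] | dom_forcing D) #|D| ]|.

End GraphParameters.

Section Helm.
Variable m : nat.

(* [None] is the center, [Some (inl i)] is the cycle vertex of index i and
   [Some (inr i)] is the pendant vertex attached to it. *)
Definition helm_vertex : finType := option ('I_m + 'I_m).

(* [ordS] is the cyclic successor on 'I_m. The condition [i != j] only rules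
   out the loop that would appear when m = 1; it is redundant for m >= 2. *)
Definition cycle_adj (i j : 'I_m) : bool :=
  (i != j) && ((j == ordS i) || (i == ordS j)).

Definition helm_adj : rel helm_vertex := fun x y =>
  match x, y with
  | None, Some (inl _) | Some (inl _), None => true
  | Some (inl i), Some (inl j) => cycle_adj i j
  | Some (inl i), Some (inr j) | Some (inr i), Some (inl j) => i == j
  | _, _ => false
  end.

Lemma helm_adj_sym : symmetric helm_adj.
Proof.
case=> [[i|i]|] [[j|j]|] //=.
by rewrite /cycle_adj eq_sym orbC.
Qed.

Lemma helm_adj_irrefl : irreflexive helm_adj.
Proof. by case=> [[i|i]|] //=; rewrite /cycle_adj eqxx. Qed.

Definition helm : sgraph := SGraph helm_adj_sym helm_adj_irrefl.

End Helm.

(* Main.v *)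
(** The closed neighbourhoods [{u_i, v_i}] of the [m] pendant vertices are
    pairwise disjoint, and a dominating set meets each of them; so it has at
    least [m] elements. Conversely, [{v_j} U {u_i | i <> j}] is a dom-forcing
    set with [m] elements: the [u_i] force the remaining cycle vertices, any
    [v_k] with [k <> j] then forces the center, and [v_j] forces [u_j]. *)
Require Import Defs.
From mathcomp Require Import all_boot.

Set Implicit Arguments.
Unset Strict Implicit.
Unset Printing Implicit Defensive.

Section GraphLemmas.
Variable G : sgraph.
Implicit Types B D : {set G}.

Lemma forcesP B (x y : G) :
  x \in B -> adj x y -> y \notin B ->
  (forall z, adj x z -> z != y -> z \in B) -> forces B x y.
Proof.
move=> xB xy yB black; rewrite /forces xB; apply/eqP/setP => z; rewrite !inE.
have [-> | zy] := eqVneq z y; first by rewrite xy yB.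
by apply/negbTE/negP => /andP[xz]; rewrite (black z xz zy).
Qed.

Lemma forces_notin B (x y : G) : forces B x y -> y \notin B.
Proof.
case/andP=> _ /eqP/setP/(_ y); rewrite !inE eqxx.
by case/andP.
Qed.

(** Each force adds a white vertex, so the process can only stop at the full set. Quantifying over
    all supersets [B] of [D] makes the hypothesis pass to [y |: D]. *)
Lemma zero_forcing_unblocked D :
  (forall B, D \subset B -> B != [set: G] ->
     exists x, exists y, forces B x y) ->
  zero_forcing D.
Proof.
move=> unblocked; rewrite /zero_forcing.
(* Induction on a bound [n] for the number of white vertices. *)
move: {2}#|_| (leqnn #|~: D|) unblocked => n.
elim: n D => [|n IHn] D leDn unblocked.
  by move: leDn; rewrite leqn0 cards_eq0 -subset0 subCset setC0 subTset
       => /eqP->; exact: connect0.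
have [-> | DnT] := eqVneq D setT; first exact: connect0.
have [x [y Dxy]] := unblocked D (subxx D) DnT.
apply: (@connect_trans _ _ (y |: D)).
  by apply: connect1; apply/existsP; exists x; apply/existsP; exists y;
     rewrite Dxy eqxx.
apply: IHn => [|B sDB]; last first.
  by apply: unblocked; apply: subset_trans (subsetUr _ _) sDB.
rewrite -ltnS; apply: leq_trans leDn; apply: proper_card.
rewrite properC; apply: properUr.
by rewrite sub1set (forces_notin Dxy).
Qed.

Lemma domination_number_eq k D :
  dominating D -> #|D| = k -> (forall D', dominating D' -> k <= #|D'|) ->
  domination_number G = k.
Proof.
move=> domD cardD lb; rewrite /domination_number.
case: arg_minnP => [|A domA minA]; first exact: dominatingT.
by apply/eqP; rewrite eqn_leq lb // andbT -cardD minA.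
Qed.

Lemma dom_forcing_number_eq k D :
  dom_forcing D -> #|D| = k -> (forall D', dom_forcing D' -> k <= #|D'|) ->
  dom_forcing_number G = k.
Proof.
move=> dfD cardD lb; rewrite /dom_forcing_number.
case: arg_minnP => [|A dfA minA]; first exact: dom_forcingT.
by apply/eqP; rewrite eqn_leq lb // andbT -cardD minA.
Qed.

End GraphLemmas.

Section Helm.
Variable m : nat.
Implicit Types (i j k : 'I_m) (B D : {set helm m}).

Definition center : helm m := None.
Definition rim i : helm m := Some (inl i).
Definition pendant i : helm m := Some (inr i).

Lemma helm_dominating_card D : dominating D -> m <= #|D|.
Proof.
move=> /forallP domD.
(* [f] selects a member of [D] from each pair: when [pendant i] is not in [D], its only neighbor
   [rim i] must be. *)
pose f i := if pendant i \in D then pendant i else rim i.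
have f_inj : injective f.
  by move=> i i'; rewrite /f; case: ifP => _; case: ifP => _ // [].
rewrite -[leqLHS]card_ord -(card_image f_inj); apply/subset_leq_card/subsetP.
move=> _ /imageP[i _ ->]; rewrite /f; case: ifP => // uiD.
have /orP[|] := domD (pendant i); first by rewrite uiD.
by case/existsP=> -[[i'|i']|] /andP[yD] //= /eqP ->.
Qed.

(** Presenting the dom-forcing set as the image of an injective map on ['I_m] gives its cardinality
    at once. *)
Definition spoke j i : helm m := if i == j then rim i else pendant i.
Definition spokes j : {set helm m} := [set spoke j i | i : 'I_m].

Lemma card_spokes j : #|spokes j| = m.
Proof.
rewrite card_imset ?card_ord // => i i'.
by rewrite /spoke; case: ifP => _; case: ifP => _ // [].
Qed.

Lemma rim_spokes j : rim j \in spokes j.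
Proof. by apply/imsetP; exists j => //; rewrite /spoke eqxx. Qed.

Lemma pendant_spokes j i : i != j -> pendant i \in spokes j.
Proof. by move=> ij; apply/imsetP; exists i => //; rewrite /spoke (negbTE ij). Qed.

Lemma dominating_spokes j : dominating (spokes j).
Proof.
apply/forallP => -[[i|i]|]; apply/orP.
- have [->|ij] := eqVneq i j; first by left; exact: rim_spokes.
  right; apply/existsP; exists (pendant i).
  by rewrite (pendant_spokes ij) /= eqxx.
- have [->|ij] := eqVneq i j; last by left; exact: pendant_spokes.
  by right; apply/existsP; exists (rim j); rewrite rim_spokes /= eqxx.
- by right; apply/existsP; exists (rim j); rewrite rim_spokes.
Qed.

Lemma zero_forcing_spokes j k : k != j -> zero_forcing (spokes j).
Proof.
move=> kj; apply: zero_forcing_unblocked => B /subsetP sDB BnT.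
(* First case: a white [rim i] has [i != j], so [pendant i] is black and forces it. *)
have [/forallP rimB | /forallPn[i iB]] := boolP [forall i, rim i \in B]; last first.
  have ij : i != j by apply: contraNneq iB => ->; apply/sDB/rim_spokes.
  exists (pendant i), (rim i); apply: forcesP => //=.
  - exact/sDB/pendant_spokes.
  - by case=> [[i'|i']|] //= /eqP <-; rewrite eqxx.
have [cB | cB] := boolP (center \in B); last first.
  (* Since [k != j], [pendant k] is black, which leaves the center as the only white neighbor of
     [rim k]. *)
  exists (rim k), center; apply: forcesP => //.
  case=> [[i|i]|] //= => [_ _|/eqP <- _]; first exact: rimB.
  exact/sDB/pendant_spokes.
have [y yB] : exists y, y \notin B.
  by apply/existsP; apply: contraR BnT; rewrite negb_exists => /forallP h;
     apply/eqP/setP => y; rewrite inE; apply/negPn/h.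
(* With the rim and the center black, a white vertex is some [pendant i], the only white neighbor of
   [rim i]. *)
case: y yB => [[i|i]|] yB; [by rewrite rimB in yB | | by rewrite cB in yB].
exists (rim i), (pendant i); apply: forcesP => //=.
by case=> [[i'|i']|] //= => [_ _|/eqP <-]; [exact: rimB | rewrite eqxx].
Qed.

End Helm.

Theorem theorem4p2 (m : nat) (hm : 4 <= m) :
  dom_forcing_number (helm m) = m /\ m = domination_number (helm m).
Proof.
(* The indices 0 and 1: [j] fixes the set [spokes j], and [k != j] gives the rim vertex that forces
   the center. *)
pose j : 'I_m := Ordinal (leq_trans (isT : 0 < 4) hm).
pose k : 'I_m := Ordinal (leq_trans (isT : 1 < 4) hm).
split; last first.
  apply/esym/(domination_number_eq (dominating_spokes j) (card_spokes j)).
  exact: helm_dominating_card.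
apply: dom_forcing_number_eq (card_spokes j) _.
  by rewrite /dom_forcing dominating_spokes (@zero_forcing_spokes _ j k).
by move=> D /andP[domD _]; exact: helm_dominating_card.
Qed.
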